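(* Let $q\in\mathbb{k}$ be nonzero, and let $\eta$ be the character on the Hopf monoid of directed graphs $\mathbf{DG}$ defined by $\eta(g)=q^{|E|}$ for a directed graph $g=(I,E)$. Let $\psi_g(n)$ be the AA polynomial obtained from $\eta$. Then for any directed graph $g=(I,E)$ (with finite vertex set $I$) and all $n\in\mathbb{N}$ we have $$\psi_g(n)=q^{|E|}\,B_g(n,1/q,0).$$
   Context: Fix a field $\mathbb{k}$ (it may for instance be a field of rational functions in which $q$ is an indeterminate). A directed graph $g=(I,E)$ with finite vertex set $I$ has a set $E\subseteq I\times I$ of directed edges (no parallel edges); $(u,v)$ denotes the edge from $u$ to $v$. Write $[n]=\{1,\dots,n\}$. A decomposition $I=S_1\sqcup\cdots\sqcup S_n$ is an ordered $n$-tuple of pairwise disjoint, possibly empty subsets with union $I$. A subset $S\subseteq I$ is a lower half of $g$ if every directed edge connecting $S$ and $T=I\setminus S$ is oriented from $S$ to $T$, i.e. there is no edge $(u,v)\in E$ with $u\in T$, $v\in S$. For $S\subseteq I$, $g|_S$ is the induced subgraph on $S$ (all edges of $g$ with both ends in $S$). The Hopf monoid (in vector species) $\mathbf{DG}$: $\mathbf{DG}[I]$ is the $\mathbb{k}$-vector space with basis the directed graphs with vertex set $I$; bijections $I\to J$ act by relabeling vertices; for a decomposition $I=S\sqcup T$ the product $\mu_{S,T}:\mathbf{DG}[S]\otimes\mathbf{DG}[T]\to\mathbf{DG}[I]$ sends $g_1\otimes g_2$ to the disjoint union $g_1\cdot g_2$, and the coproduct $\Delta_{S,T}:\mathbf{DG}[I]\to\mathbf{DG}[S]\otimes\mathbf{DG}[T]$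 sends $g$ to $g|_S\otimes g|_T$ if $S$ is a lower half of $g$, and to $0$ otherwise. The higher coproducts $\Delta_{S_1,\dots,S_n}:\mathbf{DG}[I]\to\mathbf{DG}[S_1]\otimes\cdots\otimes\mathbf{DG}[S_n]$ are obtained by iterating the coproducts, $\Delta_{S_1,\dots,S_n}=(\Delta_{S_1,\dots,S_{n-1}}\otimes\mathrm{id})\circ\Delta_{S_1\sqcup\cdots\sqcup S_{n-1},\,S_n}$, with $\Delta_{I}=\mathrm{id}$ for $n=1$ (the result does not depend on the order of iteration). A character $\eta$ is a family of linear maps $\eta_I:\mathbf{DG}[I]\to\mathbb{k}$ that is invariant under relabeling, multiplicative ($\eta_I(x\cdot y)=\eta_S(x)\eta_T(y)$), and sends the empty graph to $1$. The AA polynomial obtained from a character $\eta$ is, for $x\in\mathbf{DG}[I]$ and $n\in\mathbb{N}$, $$\psi_x(n)=\sum_{I=S_1\sqcup\cdots\sqcup S_n}(\eta_{S_1}\otimes\cdots\otimes\eta_{S_n})\circ\Delta_{S_1,\dots,S_n}(x),$$ the sum being over all decompositions of $I$ into $n$ possibly empty parts (for $n=0$: $\psi_x(0)=\eta_\emptyset(x)$ if $I=\emptyset$ and $0$ otherwise). The $B$-polynomial (Awan–Bernardi) of $g=(I,E)$ is $$B_g(n,y,z)=\sum_{f:I\to[n]}y^{|\{(u,v)\in E\mid f(v)>f(u)\}|}\,z^{|\{(u,v)\in E\mid f(v)<f(u)\}|},$$ with the convention $0^0=1$. *)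

(* Defs.v *)
(* Finite sets are finite subsets I : {fset K} of an arbitrary choiceType K;
   I coerces to the finType of its elements, so a directed graph on I is a set
   of edges in I * I (loops allowed). *)
From HB Require Import structures.
From mathcomp Require Import all_boot all_order all_algebra finmap.

Set Implicit Arguments.
Unset Strict Implicit.
Unset Printing Implicit Defensive.

Import GRing.Theory.
Local Open Scope ring_scope.

Notation freemod k B := {ffun B -> k^o}.

Section Free.
Variable k : fieldType.

Definition basis (B : finType) (b : B) : freemod k B := [ffun b' => (b' == b)%:R].

Definition lin_ext (B : finType) (V : lmodType k) (phi : B -> V) (x : freemod k B) : V :=
  \sum_(b : B) x b *: phi b.

Lemma lin_ext_linear (B : finType) (V : lmodType k) (phi : B -> V) : linear (lin_ext phi).
Proof.
move=> a x y; rewrite /lin_ext scaler_sumr -big_split /=; apply: eq_bigr => b _.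
by rewrite !ffunE scalerDl scalerA.
Qed.

Lemma lin_ext_basis (B : finType) (V : lmodType k) (phi : B -> V) b :
  lin_ext phi (basis b) = phi b.
Proof.
rewrite /lin_ext (bigD1 b) //= big1 => [|c cb]; rewrite ffunE.
  by rewrite eqxx scale1r addr0.
by rewrite (negPf cb) scale0r.
Qed.

Lemma lin_ext_comp (A B : finType) (V : lmodType k) (phi : A -> freemod k B) (psi : B -> V) x :
  lin_ext psi (lin_ext phi x) = lin_ext (fun a => lin_ext psi (phi a)) x.
Proof.
rewrite {1 3}/lin_ext.
under eq_bigr => b _ do rewrite sum_ffunE scaler_suml.
rewrite exchange_big /=; apply: eq_bigr => a _; rewrite scaler_sumr.
by apply: eq_bigr => b _; rewrite ffunE scalerA.
Qed.

(* freemod k (A * B) is the tensor product of freemod k A and freemod k B, with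
   basis (a, b) in the role of basis a (x) basis b. *)
Definition tens (A B : finType) (x : freemod k A) (y : freemod k B) : freemod k (A * B)%type :=
  [ffun p => x p.1 * y p.2].

Definition tens_map (A A' B B' : finType)
    (f : freemod k A -> freemod k A') (h : freemod k B -> freemod k B') :
    freemod k (A * B)%type -> freemod k (A' * B')%type :=
  lin_ext (fun p : A * B => tens (f (basis p.1)) (h (basis p.2))).

(* f (x) h followed by the identification of k (x) k with k. *)
Definition tens_form (A B : finType) (f : freemod k A -> k) (h : freemod k B -> k) :
    freemod k (A * B)%type -> k :=
  lin_ext (fun p : A * B => f (basis p.1) * h (basis p.2) : k^o).

End Free.

Notation digraph I := {set I * I}.

Section Digraph.
Variable K : choiceType.
Implicit Types I S T : {fset K}.

Definition has_edge I (g : digraph I) (u v : K) : bool :=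
  [exists e in g, (val e.1 == u) && (val e.2 == v)].

(* Meaningful when S is a subset of I. *)
Definition induced I S (g : digraph I) : digraph S :=
  [set e : S * S | has_edge g (val e.1) (val e.2)].

(* Meaningful when I is the disjoint union of S and T. *)
Definition disj_union I S T (g1 : digraph S) (g2 : digraph T) : digraph I :=
  [set e : I * I | has_edge g1 (val e.1) (val e.2) || has_edge g2 (val e.1) (val e.2)].

Definition lower_half I (g : digraph I) S : bool :=
  ~~ [exists e in g, (val e.1 \notin S) && (val e.2 \in S)].

Definition decomp2 I S T : bool := (I == S `|` T)%fset && [disjoint S & T]%fset.

Definition decomposition I n (S : 'I_n -> {fset K}) : bool :=
  (I == \bigcup_(i in 'I_n) S i)%fset &&
  [forall i, forall j, (i != j) ==> [disjoint S i & S j]%fset].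

Lemma has_edgeE I (g : digraph I) (u v : I) : has_edge g (val u) (val v) = ((u, v) \in g).
Proof.
apply/existsP/idP => [[[a b]] /and3P[ab_g /eqP /val_inj /= <- /eqP /val_inj /= <-] //|uv_g].
by exists (u, v); rewrite uv_g !eqxx.
Qed.

Lemma induced_id I (g : digraph I) : induced I g = g.
Proof. by apply/setP => -[u v]; rewrite inE has_edgeE. Qed.

End Digraph.

Definition relabel (K L : choiceType) (I : {fset K}) (J : {fset L}) (f : I -> J)
    (g : digraph I) : digraph J :=
  [set (f e.1, f e.2) | e in g].

Section HopfMonoid.
Variable k : fieldType.

Definition DG (K : choiceType) (I : {fset K}) := freemod k (digraph I).

Definition DG_map (K L : choiceType) (I : {fset K}) (J : {fset L}) (f : I -> J) :
    DG I -> DG J :=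
  lin_ext (fun g : digraph I => basis k (relabel f g)).

Variable K : choiceType.
Implicit Types I S T : {fset K}.

Definition DG_mul I S T : freemod k (digraph S * digraph T)%type -> DG I :=
  lin_ext (fun p : digraph S * digraph T => basis k (disj_union I p.1 p.2)).

Definition DG_coprod I S T : DG I -> freemod k (digraph S * digraph T)%type :=
  lin_ext (fun g : digraph I =>
    if lower_half g S then basis k (induced S g, induced T g) else 0).

(* The identity of DG[I] when I = J, by DG_idE below; allowing J to be only
   propositionally equal to I avoids a type cast. *)
Definition DG_id I J : DG I -> DG J :=
  lin_ext (fun g : digraph I => basis k (induced J g)).

Lemma DG_idE I : @DG_id I I =1 id.
Proof.
move=> x; apply/ffunP => g; rewrite /DG_id /lin_ext sum_ffunE (bigD1 g) //= big1.
  by rewrite !ffunE induced_id eqxx addr0 [_ *: _]mulr1.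
by move=> h hg; rewrite !ffunE induced_id eq_sym (negPf hg) [_ *: _]mulr0.
Qed.

Definition init_parts n (P : 'I_n.+2 -> {fset K}) : 'I_n.+1 -> {fset K} :=
  fun i => P (widen_ord (leqnSn n.+1) i).

(* Basis of DG[S_1] (x) ... (x) DG[S_(n+1)], left-nested. *)
Fixpoint tens_basis n : ('I_n.+1 -> {fset K}) -> finType :=
  match n with
  | 0 => fun P => digraph (P ord0)
  | n'.+1 => fun P => (tens_basis (init_parts P) * digraph (P ord_max))%type
  end.

Fixpoint iter_coprod n I : forall P : 'I_n.+1 -> {fset K}, DG I -> freemod k (tens_basis P) :=
  match n with
  | 0 => fun P => @DG_id I (P ord0)
  | n'.+1 => fun P x =>
      let U := (\bigcup_(i in 'I_n'.+1) init_parts P i)%fset in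
      tens_map (@iter_coprod n' U (init_parts P)) id (@DG_coprod I U (P ord_max) x)
  end.

End HopfMonoid.

Record character (k : fieldType) := Character {
  char_fun :> forall (K : choiceType) (I : {fset K}), DG k I -> k;
  char_linear : forall (K : choiceType) (I : {fset K}), scalar (@char_fun K I);
  char_relabel : forall (K L : choiceType) (I : {fset K}) (J : {fset L}) (f : I -> J),
    bijective f -> forall x : DG k I, char_fun (DG_map f x) = char_fun x;
  char_mul : forall (K : choiceType) (I S T : {fset K}), decomp2 I S T ->
    forall (x : DG k S) (y : DG k T),
    char_fun (DG_mul I (tens x y)) = char_fun x * char_fun y;
  char_unit : forall K : choiceType,
    char_fun (basis k (set0 : digraph (fset0 : {fset K}))) = 1
}.

Section AAPolynomial.
Variables (k : fieldType) (eta : character k) (K : choiceType).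

Fixpoint char_tens n : forall S : 'I_n.+1 -> {fset K}, freemod k (tens_basis S) -> k :=
  match n with
  | 0 => fun S => @char_fun k eta K (S ord0)
  | n'.+1 => fun S =>
      tens_form (@char_tens n' (init_parts S)) (@char_fun k eta K (S ord_max))
  end.

(* Decompositions into n parts are n-tuples of subsets of I, empty parts
   allowed. *)
Definition AA_poly (I : {fset K}) (x : DG k I) (n : nat) : k :=
  match n with
  | 0 => if I == fset0 then eta K I x else 0
  | m.+1 =>
      \sum_(S : {ffun 'I_m.+1 -> fpowerset I} | decomposition I (fun i => val (S i)))
        char_tens (@iter_coprod k K m I (fun i => val (S i)) x)
  end.

End AAPolynomial.

(* The colour set [n] is 'I_n = {0, ..., n-1}; note 0 ^+ 0 = 1. *)
Definition B_poly (k : fieldType) (K : choiceType) (I : {fset K}) (g : digraph I)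
    (n : nat) (y z : k) : k :=
  \sum_(f : {ffun I -> 'I_n})
    y ^+ #|[set e in g | (f e.1 < f e.2)%N]| * z ^+ #|[set e in g | (f e.2 < f e.1)%N]|.

Section EdgeCharacter.
Variables (k : fieldType) (q : k).

Definition edge_fun (K : choiceType) (I : {fset K}) : DG k I -> k :=
  lin_ext (fun g : digraph I => q ^+ #|g| : k^o).

Lemma edge_fun_linear (K : choiceType) (I : {fset K}) : scalar (@edge_fun K I).
Proof. exact: (lin_ext_linear (V := k^o)). Qed.

Lemma edge_fun_basis (K : choiceType) (I : {fset K}) (g : digraph I) :
  edge_fun (basis k g) = q ^+ #|g|.
Proof. by rewrite /edge_fun lin_ext_basis. Qed.

Lemma edge_fun_relabel (K L : choiceType) (I : {fset K}) (J : {fset L}) (f : I -> J) :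
  bijective f -> forall x : DG k I, edge_fun (DG_map f x) = edge_fun x.
Proof.
move=> /bij_inj f_inj x; rewrite /edge_fun /DG_map lin_ext_comp; apply: eq_bigr => g _.
by rewrite lin_ext_basis card_imset // => -[a b] [c d] [/f_inj -> /f_inj ->].
Qed.

Lemma card_disj_union (K : choiceType) (I S T : {fset K}) (g1 : digraph S) (g2 : digraph T) :
  decomp2 I S T -> #|disj_union I g1 g2| = (#|g1| + #|g2|)%N.
Proof.
case/andP=> /eqP defI dST.
have card_part (R : {fset K}) (g : digraph R) : (R `<=` I)%fset ->
    #|[set e : I * I | has_edge g (val e.1) (val e.2)]| = #|g|.
  move=> sRI; rewrite -[RHS](card_imset _ (f := fun e => (fincl sRI e.1, fincl sRI e.2))).
    apply: eq_card => -[u v]; rewrite inE /=.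
    apply/existsP/imsetP => [[[a b]] /and3P[ab_g /eqP au /eqP bv]|[[a b] ab_g [-> ->]]].
      by exists (a, b) => //=; congr pair; apply: val_inj.
    by exists (a, b); rewrite ab_g !eqxx.
  by move=> [a b] [c d] /= [ac bd]; congr pair; apply: val_inj.
rewrite -(card_part S) ?defI ?fsubsetUl //.
rewrite -(card_part T) ?defI ?fsubsetUr //.
rewrite -cardsUI [X in (_ + X)%N]eq_card0 ?addn0 => [|e].
  by apply: eq_card => e; rewrite !inE.
rewrite !inE; apply/negP => /andP[/existsP[[a b] /and3P[_ /eqP ae _]]].
case/existsP=> -[c d] /and3P[_ /eqP ce _].
rewrite /= in ae ce; have := fdisjointP dST _ (fsvalP a).
by rewrite ae -ce fsvalP.
Qed.

Lemma edge_fun_mul (K : choiceType) (I S T : {fset K}) : decomp2 I S T ->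
  forall (x : DG k S) (y : DG k T),
  edge_fun (DG_mul I (tens x y)) = edge_fun x * edge_fun y.
Proof.
move=> dI x y; rewrite /edge_fun /DG_mul lin_ext_comp /lin_ext mulr_suml.
under [RHS]eq_bigr => g1 _ do rewrite mulr_sumr.
rewrite pair_bigA /=; apply: eq_bigr => -[g1 g2] _ /=.
rewrite -/(lin_ext _ _) lin_ext_basis card_disj_union // ffunE exprD /=.
by rewrite /GRing.scale /= mulrACA.
Qed.

Lemma edge_fun_unit (K : choiceType) :
  edge_fun (basis k (set0 : digraph (fset0 : {fset K}))) = 1.
Proof. by rewrite edge_fun_basis cards0 expr0. Qed.

Definition edge_character : character k :=
  Character edge_fun_linear edge_fun_relabel edge_fun_mul edge_fun_unit.

End EdgeCharacter.

(* Main.v *)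
(** A decomposition of I into n possibly empty parts is a colouring f : I -> [n].
    Unfolding the iterated coproduct, it annihilates g unless no edge (u, v) has
    f v < f u, and otherwise it yields the tensor product of the graphs induced
    on the colour classes, on which eta takes the value q ^ m, where m counts the
    edges inside the colour classes.  Writing the vanishing condition as a
    power of 0 turns each term into q ^ m * 0 ^ d, where d counts the
    descending edges; since |E| = a + m + d, with a the number of ascending edges,
    this is the f-term of q ^ |E| * B_g(n, 1/q, 0). *)
Require Import Defs.
From mathcomp Require Import all_boot all_order all_algebra finmap.
From mathcomp Require Import zify.

Set Implicit Arguments.
Unset Strict Implicit.
Unset Printing Implicit Defensive.

Import GRing.Theory.
Local Open Scope ring_scope.

(** * Linear forms on free modules and tensor products *)

Section FreeModules.
Context {k : fieldType}.

Lemma scalar0 (V : lmodType k) (f : V -> k) : scalar f -> f 0 = 0.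
Proof. by move=> lf; have := lf (-1) 0 0; rewrite scaler0 addr0 mulN1r addNr. Qed.

Lemma scalar_lin_ext (B : finType) (f : freemod k B -> k) x :
  scalar f -> f x = \sum_b x b * f (basis k b).
Proof.
move=> lf; have {1}-> : x = \sum_b x b *: basis k b.
  apply/ffunP => b; rewrite sum_ffunE (bigD1 b) //= big1 => [|c cb].
    by rewrite !ffunE eqxx addr0 [_ *: _]mulr1.
  by rewrite !ffunE eq_sym (negPf cb) [_ *: _]mulr0.
apply: (big_rec2 (fun u v => f u = v)); first exact: scalar0.
by move=> b y z _ <-; rewrite lf.
Qed.

Lemma tens_form_scalar (A B : finType) (f : freemod k A -> k) (h : freemod k B -> k) :
  scalar (tens_form f h).
Proof. exact: (lin_ext_linear (V := k^o)). Qed.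

(** [tens_form] prescribes values on pairs of basis vectors only; expanding [x] and [y] in their
    bases extends the formula to all pure tensors. *)
Lemma tens_form_tens (A B : finType) (f : freemod k A -> k) (h : freemod k B -> k) x y :
  scalar f -> scalar h -> tens_form f h (tens x y) = f x * h y.
Proof.
move=> lf lh; rewrite /tens_form /lin_ext (scalar_lin_ext x lf) (scalar_lin_ext y lh).
rewrite mulr_suml; under [RHS]eq_bigr => a _ do rewrite mulr_sumr.
rewrite pair_bigA /=; apply: eq_bigr => -[a b] _ /=.
by rewrite ffunE /GRing.scale /= mulrACA.
Qed.

Lemma char_tens_scalar (eta : character k) (K : choiceType) n (P : 'I_n.+1 -> {fset K}) :
  scalar (char_tens eta (S := P)).
Proof. by case: n P => [|n] P; [exact: char_linear|exact: tens_form_scalar]. Qed.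

(** On a basis graph the outermost coproduct is a single basis tensor or 0, so an induction on the
    number of parts never leaves basis graphs. *)
Lemma iter_coprodS n (K : choiceType) (I : {fset K}) (P : 'I_n.+2 -> {fset K})
    (g : digraph I) (U := (\bigcup_(i in 'I_n.+1) init_parts P i)%fset) :
  iter_coprod P (basis k g) =
  if lower_half g U
  then tens (iter_coprod (init_parts P) (basis k (induced U g)))
            (basis k (induced (P ord_max) g))
  else 0.
Proof.
rewrite /= /DG_coprod lin_ext_basis -/U /tens_map; case: ifP => _.
  by rewrite lin_ext_basis.
by rewrite /lin_ext big1 // => b _; rewrite ffunE scale0r.
Qed.

End FreeModules.

(** * Edge counts, and the character on iterated coproducts *)

Section Edges.
Context {K : choiceType}.
Implicit Types (I S : {fset K}) (r : rel K).

(** The relation lives on [K], not on [I], so that one relation serves a graph and all its induced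
    subgraphs. *)
Definition nedges {I} (g : digraph I) r : nat := #|[set e in g | r (val e.1) (val e.2)]|.

Lemma eq_nedges I (g : digraph I) r1 r2 :
  (forall u v, u \in I -> v \in I -> r1 u v = r2 u v) -> nedges g r1 = nedges g r2.
Proof. by move=> eqr; apply: eq_card => e; rewrite !inE eqr ?fsvalP. Qed.

Lemma nedgesU I (g : digraph I) r1 r2 :
  (forall u v, u \in I -> v \in I -> ~~ (r1 u v && r2 u v)) ->
  nedges g (fun u v => r1 u v || r2 u v) = (nedges g r1 + nedges g r2)%N.
Proof.
move=> disj; rewrite /nedges -cardsUI [X in (_ + X)%N]eq_card0 ?addn0 => [|e].
  by apply: eq_card => e; rewrite !inE andb_orr.
by rewrite !inE andbACA (negPf (disj _ _ _ _)) ?fsvalP // andbF.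
Qed.

Lemma nedges_induced I S (g : digraph I) r : (S `<=` I)%fset ->
  nedges (induced S g) r = nedges g (fun u v => [&& u \in S, v \in S & r u v]).
Proof.
move=> sSI; rewrite /nedges.
rewrite -[LHS](card_imset _ (f := fun e => (fincl sSI e.1, fincl sSI e.2))); last first.
  by move=> [a b] [c d] /= [ac bd]; congr pair; apply: val_inj.
apply: eq_card => -[u v]; rewrite !inE /=; apply/imsetP/idP.
  case=> -[a b]; rewrite !inE /= => /andP[abg rab] [-> ->] /=.
  by rewrite -has_edgeE /= abg !fsvalP rab.
case/and4P=> uvg uS vS ruv; exists ([` uS]%fset, [` vS]%fset).
  by rewrite !inE /= has_edgeE uvg.
by congr pair; apply: val_inj.
Qed.

Lemma nedgesT I (g : digraph I) : nedges g (fun _ _ => true) = #|g|.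
Proof. by apply: eq_card => e; rewrite !inE andbT. Qed.

(** As the vanishing of a count, the condition can later be absorbed into an exponent of 0. *)
Lemma lower_halfE I (g : digraph I) S :
  lower_half g S = (nedges g (fun u v => (u \notin S) && (v \in S)) == 0%N).
Proof.
rewrite cards_eq0 /lower_half; apply/existsPn/eqP => [no|no e].
  by apply/setP => e; rewrite !inE; apply/negbTE/no.
by have /setP/(_ e) := no; rewrite !inE => ->.
Qed.

End Edges.

(** Induction on [n], splitting off the class of the largest colour. Since [c] is defined on all of
    [K], the same colouring serves the graph induced on the remaining classes. *)
Lemma char_tens_iter_coprod (k : fieldType) (q : k) (K : choiceType) n (I : {fset K})
    (P : 'I_n.+1 -> {fset K}) (c : K -> nat) (g : digraph I) :
  (forall x, x \in I -> c x <= n)%N ->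
  (forall i x, (x \in P i) = (x \in I) && (c x == i)) ->
  char_tens (edge_character q) (iter_coprod P (basis k g)) =
  q ^+ nedges g (fun u v => c u == c v) * 0 ^+ nedges g (fun u v => c v < c u)%N.
Proof.
elim: n I P g => [|n IHn] I P g c_le PE.
  (* With one part every vertex has colour 0. *)
  have eqI : P ord0 = I.
    by apply/fsetP => x; rewrite PE; case xI: (x \in I) => //=; have := c_le x xI; lia.
  rewrite /= /DG_id lin_ext_basis edge_fun_basis eqI induced_id -nedgesT.
  have -> : nedges g (fun u v => c v < c u)%N = nedges g (fun _ _ => false).
    by apply: eq_nedges => u v /c_le ? /c_le ?; lia.
  rewrite [X in 0 ^+ X]eq_card0 => [|e]; last by rewrite !inE andbF.
  by rewrite mulr1; congr (_ ^+ _); apply: eq_nedges => u v /c_le ? /c_le ?; lia.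
rewrite iter_coprodS; set U := (\bigcup_(i in _) _)%fset.
have UE x : (x \in U) = (x \in I) && (c x <= n)%N.
  apply/bigfcupP/andP => [[i _]|[xI cx]].
    by rewrite PE /= => /andP[-> /eqP ->]; rewrite -ltnS ltn_ord.
  by exists (inord (c x)); rewrite ?mem_index_enum // PE xI /= inordK.
have sUI : (U `<=` I)%fset by apply/fsubsetP => x; rewrite UE => /andP[].
have sPI : (P ord_max `<=` I)%fset by apply/fsubsetP => x; rewrite PE => /andP[].
(* A descending edge either goes from the top colour [n.+1] into [U] or stays inside [U]. *)
have descE : nedges g (fun u v => c v < c u)%N =
    (nedges g (fun u v => (u \notin U) && (v \in U)) +
     nedges (induced U g) (fun u v => c v < c u))%N.
  rewrite nedges_induced // -nedgesU => [|u v _ _]; last first.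
    by case: (u \in U); rewrite ?andbF.
  by apply: eq_nedges => u v uI vI; rewrite !UE uI vI /=; move: (c_le u uI) (c_le v vI); lia.
have monoE : nedges g (fun u v => c u == c v) =
    (nedges (induced U g) (fun u v => c u == c v) + #|induced (P ord_max) g|)%N.
  rewrite -nedgesT !nedges_induced // -nedgesU => [|u v uI vI]; last first.
    by rewrite !UE !PE uI vI /=; lia.
  apply: eq_nedges => u v uI vI; rewrite !UE !PE uI vI /=.
  by move: (c_le u uI) (c_le v vI); lia.
(* If an edge enters [U], the coproduct is 0, and so is the right-hand side, which contains a
   positive power of 0. *)
rewrite lower_halfE descE monoE; case: eqP => [->|/eqP nlow]; last first.
  rewrite (scalar0 (@char_tens_scalar _ _ _ _ P)).
  by rewrite [0 ^+ _]exprD expr0n (negPf nlow) mul0r mulr0.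
rewrite add0n exprD mulrAC -(IHn _ (init_parts P)).
- rewrite [LHS]tens_form_tens; first by rewrite /= edge_fun_basis.
  + exact: char_tens_scalar.
  + exact: char_linear.
- by move=> x; rewrite UE => /andP[].
- move=> i x; rewrite UE PE /=; case: (x \in I) => //=.
  by have := ltn_ord i; lia.
Qed.

(** * Colourings and decompositions *)

Section ColourClasses.
Context {K : choiceType} {I : {fset K}} {m : nat}.
Implicit Types (f : {ffun I -> 'I_m.+1}) (S : {ffun 'I_m.+1 -> fpowerset I}).

(* The value 0 outside I is junk. *)
Definition colour f (x : K) : nat := oapp (fun y : I => nat_of_ord (f y)) 0%N (insub x).

Lemma colour_val f (x : I) : colour f (val x) = f x.
Proof. by rewrite /colour valK. Qed.

Lemma colour_class_subproof f i : [fset x in I | colour f x == i]%fset \in fpowerset I.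
Proof. by rewrite fpowersetE fset_sub. Qed.

Definition colour_classes f : {ffun 'I_m.+1 -> fpowerset I} :=
  [ffun i : 'I_m.+1 => [` colour_class_subproof f i]%fset].

(** The default [ord0] is reached only at a vertex in no class, which cannot happen for a
    decomposition. *)
Definition class_colouring S : {ffun I -> 'I_m.+1} :=
  [ffun x => odflt ord0 [pick i | val x \in val (S i)]].

Lemma in_colour_classes f i x :
  (x \in val (colour_classes f i)) = (x \in I) && (colour f x == i).
Proof. by rewrite ffunE /= !inE. Qed.

Lemma colour_classes_decomposition f :
  decomposition I (fun i => val (colour_classes f i)).
Proof.
apply/andP; split.
  apply/eqP/fsetP => x; apply/idP/bigfcupP => [xI|[i _]]; last first.
    by rewrite in_colour_classes => /andP[].
  exists (f [` xI]%fset); rewrite ?mem_index_enum // in_colour_classes xI.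
  by rewrite -(colour_val f) eqxx.
apply/forallP => i; apply/forallP => j; apply/implyP => neq_ij.
apply/fdisjointP => x; rewrite !in_colour_classes => /andP[-> /eqP ->] /=.
by rewrite (inj_eq val_inj).
Qed.

Lemma colour_classesK : cancel colour_classes class_colouring.
Proof.
move=> f; apply/ffunP => x; rewrite ffunE; case: pickP => [i|/(_ (f x))].
  by rewrite in_colour_classes colour_val => /andP[_ /eqP /val_inj].
by rewrite in_colour_classes colour_val eqxx fsvalP.
Qed.

(** Covering makes the [pick] succeed, and disjointness makes its result the only possible index. *)
Lemma class_colouringK S :
  decomposition I (fun i => val (S i)) -> colour_classes (class_colouring S) = S.
Proof.
case/andP=> /eqP defI /forallP disj.
have uniq i j x : x \in val (S i) -> x \in val (S j) -> i = j.
  move=> xi xj; apply/eqP; apply: contraLR xj => ij.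
  by have /forallP/(_ j)/implyP/(_ ij)/fdisjointP/(_ x xi) := disj i.
apply/ffunP => i; apply/val_inj/fsetP => x; rewrite in_colour_classes.
case xI: (x \in I) => /=; last first.
  apply/esym; apply: contraFF xI => xi; move/fsetP: defI => ->.
  by apply/bigfcupP; exists i; rewrite ?mem_index_enum.
rewrite -[x]/(val [` xI]%fset) colour_val (inj_eq val_inj) ffunE /=.
case: pickP => [j xj|none] /=.
  by apply/eqP/idP => [<- //|xi]; exact: uniq xj xi.
by move/fsetP: defI => /(_ x); rewrite xI => /esym/bigfcupP[j _ xj]; have := none j; rewrite /= xj.
Qed.

End ColourClasses.

(** * Comparison of the two sums *)

Theorem theorem4p5 (k : fieldType) (q : k) (q_neq0 : q != 0)
    (K : choiceType) (I : {fset K}) (g : digraph I) (n : nat) :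
  AA_poly (edge_character q) (basis k g) n = q ^+ #|g| * B_poly g n q^-1 0.
Proof.
case: n => [|m].
  rewrite /AA_poly /B_poly; case: (fset_0Vmem I) => [I0|[x xI]].
    have noI (x : I) : False by move/fsetP/(_ (val x)): I0; rewrite fsvalP in_fset0.
    have noE (A : {set I * I}) : #|A| = 0%N by apply: eq_card0 => -[u]; case: (noI u).
    have -> : I == fset0 by apply/eqP.
    rewrite /= edge_fun_basis noE mul1r expr0.
    (* The empty function is the only colouring of the empty set. *)
    rewrite (big_pred1 (finfun (fun x => False_rect _ (noI x)))) => [|f].
      by rewrite !noE !expr0 mulr1.
    by apply/esym/eqP/ffunP => x; case: (noI x).
  have /negPf -> : I != fset0 by apply/fset0Pn; exists x.
  by rewrite big1 ?mulr0 // => f; case: (f [` xI]%fset).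
rewrite /AA_poly /B_poly (reindex_onto colour_classes class_colouring) /=; last first.
  by move=> S; exact: class_colouringK.
rewrite mulr_sumr; apply: eq_big => [f|f _].
  by rewrite colour_classes_decomposition colour_classesK eqxx.
rewrite (@char_tens_iter_coprod _ _ _ _ _ _ (colour f)); first last.
- exact: in_colour_classes.
- by move=> x xI; rewrite -[x]/(val [` xI]%fset) colour_val -ltnS ltn_ord.
have -> : #|[set e in g | (f e.1 < f e.2)%N]| = nedges g (fun u v => colour f u < colour f v)%N.
  by apply: eq_card => e; rewrite !inE !colour_val.
have -> : #|[set e in g | (f e.2 < f e.1)%N]| = nedges g (fun u v => colour f v < colour f u)%N.
  by apply: eq_card => e; rewrite !inE !colour_val.
(* Each edge is ascending, monochromatic or descending; loops are monochromatic. *)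
have -> : #|g| = (nedges g (fun u v => colour f u < colour f v) +
    nedges g (fun u v => colour f u == colour f v) +
    nedges g (fun u v => colour f v < colour f u))%N.
  rewrite -nedgesT -nedgesU => [|u v _ _]; last lia.
  by rewrite -nedgesU => [|u v _ _]; [apply: eq_nedges => u v _ _|]; lia.
(* Without descending edges the ascending ones cancel against powers of [q^-1], as [q] is
   invertible; otherwise both sides vanish. *)
rewrite !mulrA; case: (nedges g (fun u v => colour f v < colour f u)%N) => [|d].
  by rewrite addn0 expr0 !mulr1 exprD mulrAC exprVn mulfV ?mul1r // expf_neq0.
by rewrite expr0n !mulr0.
Qed.
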